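(* Let $b$ be a prime, $d\ge 1$, $K=\mathbb{F}_b((x^{-1}))$, $A=\mathbb{F}_b[x]$. Let $T\in \mathrm{GL}_d(K)$ and let $\mathbb{X}=T(A^d)$ be an admissible lattice. Let $T=L'Q$ where $L'=(l'_{ij})\in K^{d\times d}$ is lower triangular and $Q\in \mathbb{F}_b[[x^{-1}]]^{d\times d}$ with $\det Q=1$. Let $\boldsymbol f=(f_1,\dots,f_d)\in K^d$ with $\deg(f_j)\ge 0$ for all $j$ satisfy $$\deg(f_j)\ \ge\ \max_{1\le i\le j}\deg(l'_{ji})\qquad\text{for all } 1\le j\le d .$$ Put $$t=-\deg(\det T)-M(\mathbb{X})-d+1,\qquad m=-\deg(\det T)+\sum_{j=1}^d\deg(f_j),$$ and $\mathcal{P}_{\boldsymbol f,d}=\boldsymbol f^{-1}\mathbb{X}\cap \mathbb{U}^d_b$. If $m\ge 1$ and $t\le m$, then $\mathcal{P}_{\boldsymbol f,d}$ is a $(t,m,d)$-net in $\mathbb{U}_b^d$. In particular, the value $t$ does not depend on $\boldsymbol f$ (so the $t$-values of the point sets obtained from sufficiently shrunk copies of the admissible lattice $\mathbb{X}$ are uniformly bounded). Moreover, the cubature rule $$Q_{\boldsymbol f}(\psi)=\frac{b^{\deg(\det T)}}{b^{\sum_{j=1}^d\deg(f_j)}}\sum_{\boldsymbol g\in\mathcal{P}_{\boldsymbol f,d}}\psi(\phi(\boldsymbol g)),\qquad \psi:[0,1]^d\to\mathbb{R},$$ is a QMC rule, i.e. its weight $b^{\deg(\det T)-\sum_{j}\deg(f_j)}$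 equals $1/|\mathcal{P}_{\boldsymbol f,d}|$.
   Context: $b$ is a prime, $\mathbb{F}_b$ the field with $b$ elements, identified with $\{0,1,\dots,b-1\}$. $K=\mathbb{F}_b((x^{-1}))$ is the field of formal Laurent series $\sum_{i=w}^\infty c_ix^{-i}$ ($w\in\mathbb{Z}$, $c_i\in\mathbb{F}_b$), $A=\mathbb{F}_b[x]\subset K$. For $f=\sum_{i\ge w}c_ix^{-i}$ with $c_w\ne 0$, $\deg(f)=-w$; $\deg(0)=-\infty$. $\mathbb{F}_b[[x^{-1}]]=\{f\in K:\deg f\le 0\}$. $\mathbb{U}^d_b=\{(g_1,\dots,g_d)\in K^d:\deg(g_j)<0\ \forall j\}$. The map $\phi:K\to\mathbb{R}$, $\phi(\sum_{i\ge w}c_ix^{-i})=\sum_{i\ge w}c_ib^{-i}$, is applied componentwise to vectors; it maps $\mathbb{U}^d_b$ to $[0,1]^d$. For $\mathbb{X}=T(A^d)=\{T\boldsymbol g:\boldsymbol g\in A^d\}$ with $T\in\mathrm{GL}_d(K)$, and $\boldsymbol f\in K^d$ with nonzero entries, $\boldsymbol f^{-1}\mathbb{X}=\{(f_1^{-1}g_1,\dots,f_d^{-1}g_d):(g_1,\dots,g_d)\in\mathbb{X}\}$. Dual lattice: $\mathbb{X}^\perp=\{\boldsymbol g\in K^d:\sum_j g_jh_j\in A\text{ for all }\boldsymbol h\in\mathbb{X}\}$. $M(\mathbb{X})=\inf_{\boldsymbol g\in\mathbb{X}^\perp\setminus\{\boldsymbol 0\}}\sum_{j=1}^d\deg(g_j)$.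 $\mathbb{X}$ is admissible if $M(\mathbb{X})>-\infty$. $(t,m,d)$-net in $\mathbb{U}^d_b$: let $m\ge 1$, $0\le t\le m$, $d\ge 1$ be integers. A set $\mathcal{P}\subset\mathbb{U}_b^d$ of $b^m$ points is a $(t,m,d)$-net in $\mathbb{U}^d_b$ if for all nonnegative integers $l_1,\dots,l_d$ with $l_1+\dots+l_d=m-t$ and all $h_j\in\{c_1x^{-1}+\dots+c_{l_j}x^{-l_j}:c_i\in\mathbb{F}_b\}$ ($1\le j\le d$), the set $\{\boldsymbol g\in\mathbb{U}_b^d:\deg(g_j-h_j)<-l_j\ \text{for all }1\le j\le d\}$ contains exactly $b^t$ points of $\mathcal{P}$. A QMC rule is a cubature rule all of whose weights equal $1/(\text{number of nodes})$; nodes are counted with multiplicity. *)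

(* Defs.v *)
From HB Require Import structures.
From mathcomp Require Import all_boot all_order all_algebra.
From mathcomp Require Import finmap.
From mathcomp Require Import all_classical all_reals all_analysis.

Set Implicit Arguments.
Unset Strict Implicit.
Unset Printing Implicit Defensive.

Import Order.TTheory GRing.Theory Num.Theory.
Import numFieldNormedType.Exports.
Local Open Scope classical_set_scope.
Local Open Scope ring_scope.

(* The field F((x^-1)). A series \sum_i c_i x^-i is stored as the function
   i |-> c_i, so that lcoef f i is the coefficient of x^-i (not of x^i). *)

Definition vanishes_below (F : fieldType) (w : int) (c : int -> F) : Prop :=
  forall i : int, i < w -> c i = 0.

Record laurent (F : fieldType) := Laurent {
  lcoef :> int -> F;
  _ : `[< exists w : int, vanishes_below w lcoef >] }.

HB.instance Definition _ (F : fieldType) := [isSub for @lcoef F].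
HB.instance Definition _ (F : fieldType) := [Choice of laurent F by <:].

Section LaurentField.
Variable F : fieldType.
Implicit Types (f g h : laurent F) (c : int -> F) (u v w : int).

Definition mk_laurent c (cP : exists w, vanishes_below w c) : laurent F :=
  Laurent (asboolT cP).

Lemma laurentP f g : (forall i, f i = g i) -> f = g.
Proof. by move=> fg; apply/val_inj/funext. Qed.

Lemma laurent_bound f : exists w, vanishes_below w f.
Proof. by case: f => c /= /asboolP. Qed.

Lemma vanishes_belowW u w c : (u <= w)%R ->
  vanishes_below w c -> vanishes_below u c.
Proof. by move=> uw cw i iu; apply: cw; exact: lt_le_trans uw. Qed.

Lemma zero_subproof : exists w, vanishes_below w (fun _ : int => 0 : F).
Proof. by exists 0. Qed.

Lemma add_subproof f g : exists w, vanishes_below w (fun i => f i + g i).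
Proof.
have [u fu] := laurent_bound f; have [v gv] := laurent_bound g.
exists (Num.min u v) => i; rewrite lt_min => /andP[iu iv].
by rewrite fu// gv// addr0.
Qed.

Lemma opp_subproof f : exists w, vanishes_below w (fun i => - f i).
Proof.
by have [u fu] := laurent_bound f; exists u => i iu; rewrite fu// oppr0.
Qed.

Definition lzero := mk_laurent zero_subproof.
Definition ladd f g := mk_laurent (add_subproof f g).
Definition lopp f := mk_laurent (opp_subproof f).

Lemma laddA : associative ladd.
Proof. by move=> f g h; apply: laurentP => i /=; rewrite addrA. Qed.
Lemma laddC : commutative ladd.
Proof. by move=> f g; apply: laurentP => i /=; rewrite addrC. Qed.
Lemma ladd0 : left_id lzero ladd.
Proof. by move=> f; apply: laurentP => i /=; rewrite add0r. Qed.
Lemma laddN : left_inverse lzero lopp ladd.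
Proof. by move=> f; apply: laurentP => i /=; rewrite addNr. Qed.

HB.instance Definition _ :=
  GRing.isZmodule.Build (laurent F) laddA laddC ladd0 laddN.

Lemma lcoefD f g i : (f + g) i = f i + g i. Proof. by []. Qed.
Lemma lcoefN f i : (- f) i = - f i. Proof. by []. Qed.
Lemma lcoef0 i : (0 : laurent F) i = 0. Proof. by []. Qed.

Lemma int_above u i : u <= i -> exists n : nat, i = u + n%:Z.
Proof.
by move=> ui; exists `|i - u|%N; rewrite gez0_abs ?subr_ge0// [RHS]addrC subrK.
Qed.

Definition cauchy (c c' : int -> F) (n : int) : F :=
  \sum_(i \in [set: int]) c i * c' (n - i).

Definition ltrunc (N : nat) w c : {poly F} := \poly_(i < N) c (w + i%:Z).

Lemma cauchy_low u v c c' n : vanishes_below u c -> vanishes_below v c' ->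
  n < u + v -> cauchy c c' n = 0.
Proof.
move=> cu cv nuv; apply: fsbig1 => i _.
have [iu|ui] := ltP i u; first by rewrite cu// mul0r.
by rewrite cv ?mulr0// ltrBlDl; apply: lt_le_trans nuv _; rewrite lerD2r.
Qed.

Lemma cauchyE u v c c' (n : nat) : vanishes_below u c -> vanishes_below v c' ->
  cauchy c c' (u + v + n%:Z) =
  \sum_(i < n.+1) c (u + i%:Z) * c' (v + (n - i)%N%:Z).
Proof.
move=> cu cv; rewrite /cauchy.
rewrite (fsbigE [seq u + i%:Z | i <- iota 0 n.+1]); first last.
- move=> i _ iN.
  have [iu|ui] := ltP i u; first by rewrite cu// mul0r.
  rewrite [c' _]cv ?mulr0//.
  have [k ik] := int_above ui; rewrite ik in iN *.
  have nk : (n < k)%N.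
    rewrite ltnNge; apply: contra iN => kn.
    by apply/mapP; exists k => //; rewrite mem_iota.
  have -> : u + v + n%:Z - (u + k%:Z) = v + (n%:Z - k%:Z).
    by rewrite opprD addrACA [u + v]addrC addrK.
  by rewrite gtrDl subr_lt0 ltz_nat.
- by [].
- by rewrite map_inj_uniq ?iota_uniq// => i j /addrI[].
rewrite big_map (eq_bigl xpredT); last by move=> i; rewrite in_setT.
rewrite -[iota 0 n.+1]/(index_iota 0 n.+1) big_mkord.
apply: eq_bigr => i _; congr (_ * c' _).
rewrite -subzn; last by rewrite -ltnS.
by rewrite opprD addrACA [u + v]addrC addrK.
Qed.

Lemma cauchy_trunc (N : nat) u v c c' (n : nat) : (n < N)%N ->
  vanishes_below u c -> vanishes_below v c' ->
  cauchy c c' (u + v + n%:Z) = (ltrunc N u c * ltrunc N v c')`_n.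
Proof.
move=> nN cu cv; rewrite cauchyE// coefM; apply: eq_bigr => i _.
rewrite !coef_poly (leq_ltn_trans _ nN); last by rewrite -ltnS.
by rewrite (leq_ltn_trans _ nN)// leq_subr.
Qed.

Lemma mul_subproof f g : exists w, vanishes_below w (cauchy f g).
Proof.
have [u fu] := laurent_bound f; have [v gv] := laurent_bound g.
by exists (u + v) => n; exact: cauchy_low.
Qed.

Lemma one_subproof : exists w, vanishes_below w (fun i => (i == 0)%:R : F).
Proof. by exists 0 => i i0; rewrite lt_eqF. Qed.

Definition lmul f g := mk_laurent (mul_subproof f g).
Definition lone := mk_laurent one_subproof.

Lemma lmulC : commutative lmul.
Proof.
move=> f g; apply: laurentP => i /=.
have [u fu] := laurent_bound f; have [v gv] := laurent_bound g.
have [lo|/int_above[n ->]] := ltP i (u + v).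
  by rewrite (cauchy_low fu gv)// (cauchy_low gv fu)// addrC.
rewrite (cauchy_trunc (ltnSn n) fu gv) [u + v]addrC.
by rewrite (cauchy_trunc (ltnSn n) gv fu) mulrC.
Qed.

Lemma lmulA : associative lmul.
Proof.
move=> f g h; apply: laurentP => i /=.
have [u fu] := laurent_bound f; have [v gv] := laurent_bound g.
have [w hw] := laurent_bound h.
have fguv : vanishes_below (u + v) (cauchy f g) by move=> k; exact: cauchy_low.
have ghvw : vanishes_below (v + w) (cauchy g h) by move=> k; exact: cauchy_low.
have [lo|/int_above[n ->]] := ltP i (u + v + w).
  by rewrite (cauchy_low fguv hw)// (cauchy_low fu ghvw)// addrA.
rewrite (cauchy_trunc (ltnSn n) fguv hw) -[u + v + w]addrA.
rewrite (cauchy_trunc (ltnSn n) fu ghvw).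
pose p := ltrunc n.+1 u f; pose q := ltrunc n.+1 v g.
pose r := ltrunc n.+1 w h.
transitivity ((p * (q * r))`_n).
  rewrite !coefM; apply: eq_bigr => j _; congr (_ * _).
  by rewrite coef_poly ltnS leq_subr (@cauchy_trunc n.+1 _ _ _ _ _ _ gv hw) ?ltnS ?leq_subr.
rewrite mulrA !coefM; apply: eq_bigr => j _; congr (_ * _).
by rewrite [RHS]coef_poly ltn_ord (cauchy_trunc (ltn_ord j) fu gv).
Qed.

Lemma lmul1 : left_id lone lmul.
Proof.
move=> f; apply: laurentP => i /=; rewrite /cauchy.
rewrite (fsbigE [:: 0])//=; last first.
  by move=> j _; rewrite inE => /negbTE ->; rewrite mul0r.
by rewrite big_cons big_nil in_setT eqxx mul1r addr0 subr0.
Qed.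

Lemma lmulDl : left_distributive lmul +%R.
Proof.
move=> f g h; apply: laurentP => i /=.
have [u0 fu0] := laurent_bound f; have [v0 gv0] := laurent_bound g.
have [w hw] := laurent_bound h.
pose u := Num.min u0 v0.
have fu : vanishes_below u f by apply: vanishes_belowW fu0; rewrite ge_min lexx.
have gu : vanishes_below u g.
  by apply: vanishes_belowW gv0; rewrite ge_min lexx orbT.
have fgu : vanishes_below u (f + g) by move=> k ku; rewrite /= fu// gu// addr0.
have [lo|/int_above[n ->]] := ltP i (u + w).
  rewrite (cauchy_low fgu hw)// (cauchy_low fu hw)// (cauchy_low gu hw)//.
  by rewrite addr0.
rewrite (cauchyE _ fgu hw) (cauchyE _ fu hw) (cauchyE _ gu hw) -big_split/=.
by apply: eq_bigr => j _; rewrite mulrDl.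
Qed.

Lemma lone_neq0 : lone != 0.
Proof.
apply/eqP => /(congr1 (fun f : laurent F => f 0)) /= /eqP.
by rewrite oner_eq0.
Qed.

HB.instance Definition _ := GRing.Zmodule_isComNzRing.Build (laurent F)
  lmulA lmulC lmul1 lmulDl lone_neq0.

Lemma lcoefM f g n : (f * g) n = \sum_(i \in [set: int]) f i * g (n - i).
Proof. by []. Qed.

Lemma lcoef1 i : (1 : laurent F) i = (i == 0)%:R. Proof. by []. Qed.

(* w is the index of the leading term of f. *)
Definition leading_index f w := f w != 0 /\ vanishes_below w f.

Lemma leading_index_ex f : f != 0 -> exists w, leading_index f w.
Proof.
move=> f0; have [u fu] := laurent_bound f.
have [i fi] : exists i, f i != 0.
  apply: contrapT => /forallNP fN; move/eqP: f0; apply; apply: laurentP => i.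
  by rewrite lcoef0; apply/eqP/negPn/negP/fN.
have ex : exists n : nat, f (u + n%:Z) != 0.
  have [iu|/int_above[n iE]] := ltP i u; first by rewrite fu// eqxx in fi.
  by exists n; rewrite -iE.
exists (u + (ex_minn ex)%:Z); case: ex_minnP => n fn nmin; split=> // j jn.
have [|/int_above[k jE]] := ltP j u; first exact: fu.
apply/eqP/negPn/negP; rewrite jE => /nmin.
by rewrite leqNgt -ltz_nat -(ltrD2l u) -jE jn.
Qed.

Fixpoint inv_seq (a : nat -> F) (n : nat) : seq F :=
  if n is n'.+1 then
    let s := inv_seq a n' in
    rcons s (- (a 0%N)^-1 * \sum_(i < n') a i.+1 * s`_(n' - i.+1) +
             (n' == 0%N)%:R * (a 0%N)^-1)
  else [::].

Lemma size_inv_seq a n : size (inv_seq a n) = n.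
Proof. by elim: n => //= n IH; rewrite size_rcons IH. Qed.

Lemma nth_inv_seq a n k : (k < n)%N -> (inv_seq a n)`_k = (inv_seq a k.+1)`_k.
Proof.
elim: n => // n IH; rewrite ltnS leq_eqVlt => /predU1P[->//|kn].
rewrite -(IH kn); cbn [inv_seq].
by rewrite nth_rcons size_inv_seq kn.
Qed.

Lemma inv_seq_conv a n : a 0%N != 0 ->
  \sum_(i < n.+1) a i * (inv_seq a (n - i).+1)`_(n - i) = (n == 0%N)%:R.
Proof.
move=> a0; rewrite big_ord_recl subn0.
pose S := \sum_(i < n) a i.+1 * (inv_seq a n)`_(n - i.+1).
have -> : (inv_seq a n.+1)`_n =
    - (a 0%N)^-1 * S + (n == 0%N)%:R * (a 0%N)^-1.
  by cbn [inv_seq]; rewrite nth_rcons size_inv_seq ltnn eqxx.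
rewrite mulrDr mulNr mulrN mulVKf// mulrCA mulfV// mulr1.
rewrite [X in _ + X](_ : _ = S) 1?addrAC ?addNr ?add0r//.
apply: eq_bigr => i _; rewrite lift0 [in RHS]nth_inv_seq//.
by rewrite ltn_subrL (leq_ltn_trans _ (ltn_ord i)).
Qed.

Lemma lmulV_ex f : f != 0 -> exists g, g * f = 1.
Proof.
move=> /leading_index_ex[w [fw0 fw]].
pose a (n : nat) := f (w + n%:Z).
pose c (i : int) := if i < - w then 0 else
  (inv_seq a `|i + w|.+1)`_(`|i + w|).
have cw : vanishes_below (- w) c by move=> i iw; rewrite /c iw.
have c_bound : exists u, vanishes_below u c by exists (- w).
exists (mk_laurent c_bound).
rewrite mulrC; apply: laurentP => i; rewrite lcoef1.
rewrite -[LHS]/(cauchy f c i).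
have [lo|/int_above[n]] := ltP i (w - w).
  by rewrite (cauchy_low fw cw)//; rewrite subrr in lo; rewrite lt_eqF.
move=> ->; rewrite (cauchyE _ fw cw) subrr add0r.
rewrite -[RHS](@inv_seq_conv a n); last by rewrite /a addr0.
apply: eq_bigr => j _; congr (_ * _).
rewrite /c gtrDl ltNge lez_nat leq0n /=.
by rewrite addrAC addNr add0r absz_nat.
Qed.

(* The multiplicative inverse, with the convention 0^-1 = 0. *)
Definition linv f : laurent F := xget 0 [set g | g * f = 1].

Lemma lmulVf f : f != 0 -> linv f * f = 1.
Proof.
by rewrite /linv => /lmulV_ex[g gf]; exact: (@xgetPex _ 0 [set g | g * f = 1] (ex_intro _ g gf)).
Qed.

Lemma linv0 : linv 0 = 0.
Proof.
rewrite /linv xgetPN// => g /= /eqP.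
by rewrite mulr0 eq_sym oner_eq0.
Qed.

HB.instance Definition _ :=
  GRing.ComNzRing_isField.Build (laurent F) lmulVf linv0.

End LaurentField.

Section Degree.
Variable F : fieldType.
Implicit Types (f : laurent F).

(* Junk value 0 at f = 0. *)
Definition lord f : int := xget 0 [set w | leading_index f w].

Lemma lordP f : f != 0 -> leading_index f (lord f).
Proof.
by move=> /leading_index_ex[w fw];
  exact: (@xgetPex _ 0 [set w | leading_index f w] (ex_intro _ w fw)).
Qed.

Definition deg f : \bar int := if f == 0 then -oo%E else (- lord f)%:E.

Lemma poly_laurent_subproof (p : {poly F}) :
  exists w : int, vanishes_below w (fun i => if i <= 0 then p`_`|i|%N else 0).
Proof.
exists (- (size p)%:Z) => i ip; case: ifP => // i0.
apply: nth_default; rewrite -lez_nat abszE ler0_norm//.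
by rewrite ltW// ltrNr.
Qed.

(* The inclusion of F[x] in F((x^-1)): the coefficient of x^n becomes the
   coefficient of index -n. *)
Definition poly_laurent (p : {poly F}) : laurent F :=
  mk_laurent (poly_laurent_subproof p).

Definition power_series : set (laurent F) := [set f | (deg f <= 0)%E].

End Degree.

Section Lattice.
Variables (F : fieldType) (d : nat).
Local Notation K := (laurent F).
Implicit Types (T : 'M[K]_d) (X : set 'cV[K]_d) (f g h : 'cV[K]_d).

Definition unit_box : set 'cV[K]_d := [set g | forall j, (deg (g j 0%R) < 0)%E].

(* T(A^d) with A = F[x]. *)
Definition lattice T : set 'cV[K]_d :=
  [set T *m map_mx (@poly_laurent F) g | g in [set: 'cV[{poly F}]_d]].

(* f^-1 X, entrywise. *)
Definition inv_scale f X : set 'cV[K]_d :=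
  [set \col_j ((f j 0)^-1 * g j 0) | g in X].

Definition dual X : set 'cV[K]_d :=
  [set g | forall h, X h -> range (@poly_laurent F) (\sum_j g j 0 * h j 0)].

Definition degsum g : \bar int := (\sum_j deg (g j 0%R))%E.

(* The infimum is taken in int extended by -oo and +oo, where every set has
   one. *)
Definition lattice_min X : \bar int :=
  infimum +oo%E (degsum @` (dual X `\ 0)).

Definition admissible X : Prop := (-oo < lattice_min X)%E.

End Lattice.

Section Net.
Variables (b d : nat).
Local Notation K := (laurent 'F_b).

(* The elements c_1 x^-1 + ... + c_l x^-l. *)
Definition short_expansion (l : nat) : set K :=
  [set h : K | forall i : int, ~~ (1 <= i <= l%:Z) -> h i = 0].

Definition elementary_box (l : 'I_d -> nat) (h : 'cV[K]_d) : set 'cV[K]_d :=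
  [set g | unit_box g /\
           forall j, (deg (g j 0 - h j 0)%R < (- (l j)%:Z)%:E)%E].

Definition is_net (t m : nat) (P : set 'cV[K]_d) : Prop :=
  [/\ [/\ (1 <= d)%N, (1 <= m)%N & (t <= m)%N],
      P `<=` @unit_box 'F_b d,
      (P #= `I_(b ^ m))%card &
      forall (l : 'I_d -> nat) (h : 'cV[K]_d),
        (\sum_j l j)%N = (m - t)%N ->
        (forall j, short_expansion (l j) (h j 0)) ->
        ((elementary_box l h `&` P) #= `I_(b ^ t))%card].

End Net.

Section Cubature.
Variables (R : realType) (d : nat).

(* A cubature rule is a finite list of pairs (weight, node), so that nodes are
   counted with multiplicity. *)
Definition cubature_rule := seq (R * 'cV[R]_d).

Definition cubature (Q : cubature_rule) (psi : 'cV[R]_d -> R) : R :=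
  \sum_(p <- Q) p.1 * psi p.2.

Definition real_cube : set 'cV[R]_d := [set x | forall j, 0 <= x j 0 <= 1].

Definition is_qmc (Q : cubature_rule) : Prop :=
  [/\ (0 < size Q)%N,
      forall p, p \in Q -> real_cube p.2 &
      forall p, p \in Q -> p.1 = (size Q)%:R^-1].

End Cubature.

Section ShrunkLattice.
Variables (R : realType) (b d : nat).
Local Notation K := (laurent 'F_b).

(* The coefficient f i : 'F_b is read as a natural number through the ordinal
   coercion; for b prime it is the representative in {0, ..., b - 1}. *)
Definition phi (f : K) : R :=
  limn (fun n : nat => \sum_(0 <= k < n)
    (nat_of_ord (f (lord f + k%:Z)))%:R * b%:R ^ (- (lord f + k%:Z)) : R).

Definition shrunk_points (T : 'M[K]_d) (f : 'cV[K]_d) : set 'cV[K]_d :=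
  inv_scale f (lattice T) `&` @unit_box 'F_b d.

(* fine is used on integers only: det T and the entries of f are nonzero. *)
Definition shrunk_weight (T : 'M[K]_d) (f : 'cV[K]_d) : R :=
  b%:R ^ fine (deg (\det T)) / b%:R ^ fine (\sum_j deg (f j 0%R))%E.

(* fset_set is junk on infinite sets; the point set has to be finite. *)
Definition shrunk_rule (T : 'M[K]_d) (f : 'cV[K]_d) : cubature_rule R d :=
  [seq (shrunk_weight T f, map_mx phi g) | g <- fset_set (shrunk_points T f)].

End ShrunkLattice.

(* Main.v *)
From HB Require Import structures.
Require Import Defs.
From mathcomp Require Import all_boot all_order all_algebra.
From mathcomp Require Import perm finmap.
From mathcomp Require Import all_classical all_reals all_analysis.
From mathcomp Require Import zify lra.

Set Implicit Arguments.
Unset Strict Implicit.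
Unset Printing Implicit Defensive.

Import Order.TTheory GRing.Theory Num.Theory.
Local Open Scope classical_set_scope.
Local Open Scope ring_scope.

(* The heart is a Riemann-Roch statement for lattices. Let U be the maximal
   ideal of F[[x^-1]]. If no nonzero y in U^d satisfies y T \in A^d, then
   deg (det T) = - n with n >= 0, and for every z in K^d exactly q^n vectors a
   in A^d satisfy T a - z \in U^d. Indeed, column operations over A lower the
   column degrees k_j of T until \sum_j k_j = deg (det T); then T = B x^k with
   B invertible over F[[x^-1]], the hypothesis forces k_j <= 0, and a_j is
   prescribed up to a polynomial of degree < - k_j.
   Elementary boxes of f^-1 X are counted by the matrix x^l f^-1 T. A vector y
   violating its hypothesis gives a dual vector: if \sum_j l_j = m - t, its
   degree sum would be below M(X); if l = 0, all entries of y L lie in U, so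
   that y = 0. For a rescaling of T with determinant of degree 1 the hypothesis
   must fail, which yields a short dual vector, hence t >= 0. *)

(** * The order function on Laurent series *)

Section LaurentOrder.
Variable F : fieldType.
Implicit Types (f g : laurent F) (u v w k : int).

Lemma vanishes_belowD w f g :
  vanishes_below w f -> vanishes_below w g -> vanishes_below w (f + g).
Proof. by move=> fw gw i iw; rewrite lcoefD fw// gw// addr0. Qed.

Lemma vanishes_belowN w f : vanishes_below w f -> vanishes_below w (- f).
Proof. by move=> fw i iw; rewrite lcoefN fw// oppr0. Qed.

Lemma vanishes_below1 : vanishes_below 0 (1 : laurent F).
Proof. by move=> i i0; rewrite lcoef1 lt_eqF. Qed.

Lemma vanishes_belowM u v f g : vanishes_below u f -> vanishes_below v g ->
  vanishes_below (u + v) (f * g).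
Proof. by move=> fu gv n; exact: cauchy_low. Qed.

Lemma vanishes_below_sum (I : Type) (r : seq I) (P : pred I) w
    (f : I -> laurent F) :
  (forall i, P i -> vanishes_below w (f i)) ->
  vanishes_below w (\sum_(i <- r | P i) f i).
Proof.
move=> fw; elim/big_ind: _ => //; exact: vanishes_belowD.
Qed.

Lemma lcoefM_low u v f g : vanishes_below u f -> vanishes_below v g ->
  (f * g) (u + v) = f u * g v.
Proof.
move=> fu gv; rewrite -[u + v]addr0.
by rewrite [LHS](cauchyE 0%N fu gv) big_ord_recl big_ord0 !addr0.
Qed.

Lemma lcoef_sum (I : Type) (r : seq I) (P : pred I) (f : I -> laurent F) k :
  (\sum_(i <- r | P i) f i) k = \sum_(i <- r | P i) f i k.
Proof. by elim/big_rec2: _ => // i _ y _ <-; rewrite lcoefD. Qed.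

Lemma leading_indexM u v f g :
  leading_index f u -> leading_index g v -> leading_index (f * g) (u + v).
Proof.
move=> [fu fuv] [gv gvv]; split; last exact: vanishes_belowM.
by rewrite lcoefM_low// mulf_neq0.
Qed.

Lemma leading_index_lord f w : leading_index f w -> lord f = w.
Proof.
move=> [fw fwv].
have f0 : f != 0 by apply: contraNneq fw => ->; rewrite lcoef0.
have [lw lwv] := lordP f0.
apply/eqP; rewrite eq_le !leNgt; apply/andP; split; apply/negP => ?.
  by rewrite lwv ?eqxx in fw.
by rewrite fwv ?eqxx in lw.
Qed.

Lemma lord1 : lord (1 : laurent F) = 0.
Proof.
apply: leading_index_lord; split; last exact: vanishes_below1.
by rewrite lcoef1 eqxx oner_eq0.
Qed.

Lemma lordM f g : f != 0 -> g != 0 -> lord (f * g) = lord f + lord g.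
Proof.
by move=> f0 g0; apply/leading_index_lord/leading_indexM; exact: lordP.
Qed.

Lemma lordV f : f != 0 -> lord f^-1 = - lord f.
Proof.
move=> f0; have fV0 : f^-1 != 0 by rewrite invr_eq0.
have := lordM f0 fV0; rewrite mulfV// lord1 => /esym/eqP.
by rewrite addrC addr_eq0 => /eqP.
Qed.

Lemma lord_prod (I : Type) (r : seq I) (P : pred I) (f : I -> laurent F) :
  (forall i, f i != 0) ->
  lord (\prod_(i <- r | P i) f i) = \sum_(i <- r | P i) lord (f i).
Proof.
move=> f0; suff : (\prod_(i <- r | P i) f i != 0) /\
    lord (\prod_(i <- r | P i) f i) = \sum_(i <- r | P i) lord (f i) by case.
elim/big_rec2: _ => [|i y1 y2 _ [y20 <-]]; first by rewrite oner_neq0 lord1.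
by rewrite mulf_neq0// lordM.
Qed.

Lemma vanishes_below_lord f w : f != 0 -> vanishes_below w f <-> w <= lord f.
Proof.
move=> f0; have [lw lwv] := lordP f0; split => [fw|wl]; last first.
  exact: vanishes_belowW lwv.
by rewrite leNgt; apply: contra lw => /fw ->.
Qed.

Lemma degE f : f != 0 -> deg f = (- lord f)%:E.
Proof. by rewrite /deg => /negbTE ->. Qed.

(** Indices are opposite to exponents, and strictness costs a shift by 1 because degrees are
    integers. Phrasing bounds through [vanishes_below] spares later case splits on the zero
    series. *)
Lemma deg_lt f k : (deg f < k%:E)%E <-> vanishes_below (1 - k) f.
Proof.
rewrite /deg; have [->|f0] := eqVneq f 0; first by rewrite ltNyr; split.
by rewrite vanishes_below_lord// lte_fin lerBlDr ltrNl -lezD1 addrC; split; lia.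
Qed.

Lemma deg_le f k : (deg f <= k%:E)%E <-> vanishes_below (- k) f.
Proof.
rewrite /deg; have [->|f0] := eqVneq f 0; first by rewrite leNye; split.
by rewrite vanishes_below_lord// lee_fin; split; lia.
Qed.

Lemma monomial_subproof k :
  exists w, vanishes_below w (fun i => (i == - k)%:R : F).
Proof. by exists (- k) => i ik; rewrite lt_eqF. Qed.

(* x^k, whose only nonzero coefficient has index - k. *)
Definition lmono k : laurent F := mk_laurent (monomial_subproof k).

Lemma lcoef_lmonoM k f i : (lmono k * f) i = f (i + k).
Proof.
rewrite lcoefM (fsbigE [:: - k])//=.
  by rewrite big_cons big_nil in_setT eqxx mul1r addr0 opprK.
by move=> j _; rewrite inE => /negbTE ->; rewrite mul0r.
Qed.

Lemma lmono0 : lmono 0 = 1.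
Proof. by apply: laurentP => i; rewrite /= oppr0. Qed.

Lemma lmonoD k l : lmono (k + l) = lmono k * lmono l.
Proof.
apply: laurentP => i; rewrite lcoef_lmonoM /=; congr ((_ : bool)%:R).
by lia.
Qed.

Lemma lmonoNK k : lmono (- k) * lmono k = 1.
Proof. by rewrite -lmonoD addNr lmono0. Qed.

Lemma leading_index_lmono k : leading_index (lmono k) (- k).
Proof.
split; first by rewrite /= eqxx oner_neq0.
by move=> i ik /=; rewrite lt_eqF.
Qed.

Lemma lmono_neq0 k : lmono k != 0.
Proof.
by have [+ _] := leading_index_lmono k; apply: contraNneq => ->; rewrite lcoef0.
Qed.

Lemma lord_lmono k : lord (lmono k) = - k.
Proof. exact/leading_index_lord/leading_index_lmono. Qed.

Lemma vanishes_below_lmonoM k w f :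
  vanishes_below w (lmono k * f) <-> vanishes_below (w + k) f.
Proof.
split => fw i iw; last by rewrite lcoef_lmonoM fw// ltrD2r.
by have := fw (i - k); rewrite lcoef_lmonoM subrK; apply; rewrite ltrBlDr.
Qed.

Lemma lcoef_poly (p : {poly F}) i :
  poly_laurent p i = if i <= 0 then p`_`|i|%N else 0.
Proof. by []. Qed.

Lemma poly_laurent_is_zmod_morphism : zmod_morphism (@poly_laurent F).
Proof.
move=> p q; apply: laurentP => i; rewrite lcoefD lcoefN !lcoef_poly.
by case: ifP; rewrite ?coefB// subrr.
Qed.
HB.instance Definition _ := GRing.isZmodMorphism.Build _ _ (@poly_laurent F)
  poly_laurent_is_zmod_morphism.

Lemma poly_laurent_lcoef (p : {poly F}) (n : nat) :
  poly_laurent p (- n%:Z) = p`_n.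
Proof. by rewrite lcoef_poly abszN absz_nat; case: ifP => //; lia. Qed.

Lemma poly_laurentC_M c f i : (poly_laurent c%:P * f) i = c * f i.
Proof.
rewrite lcoefM (fsbigE [:: 0])//=.
  by rewrite big_cons big_nil in_setT lexx absz0 coefC addr0 subr0.
move=> j _; rewrite inE => j0; case: ifP => _; last by rewrite mul0r.
by rewrite coefC absz_eq0 (negbTE j0) mul0r.
Qed.

Lemma poly_laurentX (p : {poly F}) :
  poly_laurent (p * 'X) = lmono 1 * poly_laurent p.
Proof.
apply: laurentP => i; rewrite lcoef_lmonoM !lcoef_poly coefMX absz_eq0.
have [->|i0] := eqVneq i 0; first by rewrite lexx.
case: (leP i 0) => i0'; last by case: ifP => //; lia.
rewrite ifT; last by lia.
by congr (p`__); lia.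
Qed.

Lemma poly_laurent_is_monoid_morphism : monoid_morphism (@poly_laurent F).
Proof.
split.
  apply: laurentP => i; rewrite lcoef1 lcoef_poly coef1 absz_eq0.
  by case: (leP i 0) => // i0; rewrite gt_eqF.
(* Horner induction on p: multiplication by X is an index shift, so only constants have to be
   multiplied out. *)
move=> p q; elim/poly_ind: p => [|p c IH]; first by rewrite !(mul0r, raddf0).
rewrite mulrDl mulrAC !raddfD/= !poly_laurentX IH mulrDl mulrA; congr (_ + _).
apply: laurentP => i; rewrite poly_laurentC_M !lcoef_poly coefCM.
by case: ifP; rewrite ?mulr0.
Qed.
HB.instance Definition _ := GRing.isMonoidMorphism.Build _ _ (@poly_laurent F)
  poly_laurent_is_monoid_morphism.

Lemma poly_laurentXn n : poly_laurent ('X^n : {poly F}) = lmono n%:Z.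
Proof.
elim: n => [|n IH]; first by rewrite expr0 rmorph1 lmono0.
by rewrite exprSr poly_laurentX IH -lmonoD intS.
Qed.

Lemma poly_laurent_below (p : {poly F}) (n : nat) :
  vanishes_below (1 - n%:Z) (poly_laurent p) <-> (size p <= n)%N.
Proof.
split => [pn|pn i iN]; last first.
  rewrite lcoef_poly; case: ifP => // i0; apply: nth_default.
  by apply: leq_trans pn _; lia.
apply/leq_sizeP => j nj; rewrite -poly_laurent_lcoef pn//.
by lia.
Qed.

Lemma poly_laurent_inj : injective (@poly_laurent F).
Proof. by move=> p q pq; apply/polyP => i; rewrite -!poly_laurent_lcoef pq. Qed.

Lemma poly_laurent_small (p : {poly F}) :
  vanishes_below 1 (poly_laurent p) -> p = 0.
Proof.
move=> p1; apply/eqP; rewrite -size_poly_leq0; apply/poly_laurent_below.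
by rewrite subr0.
Qed.

Lemma poly_part_ex f : exists p, vanishes_below 1 (f - poly_laurent p).
Proof.
have [w fw] := laurent_bound f.
(* Exponents of f never exceed - w, so cutting at [|w|] keeps the whole polynomial part. *)
exists (\poly_(i < `|w|.+1) f (- i%:Z)) => i i1.
rewrite lcoefD lcoefN lcoef_poly coef_poly ifT; last by lia.
case: ifP => iw.
  by rewrite (_ : - _ = i) ?subrr//; lia.
by rewrite fw ?subr0//; lia.
Qed.

End LaurentOrder.

(** * Matrices with entries in F[[x^-1]] *)

Section IntegralMatrices.
Variable F : fieldType.
Local Notation K := (laurent F).
Implicit Types (u w : int).

Definition integral_mx m n (A : 'M[K]_(m, n)) :=
  forall i j, vanishes_below 0 (A i j).

Definition const_part m n (A : 'M[K]_(m, n)) : 'M[F]_(m, n) :=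
  map_mx (fun f : K => f 0) A.

Lemma vanishes_below_mulmx u w m n p (A : 'M[K]_(m, n)) (B : 'M[K]_(n, p)) i k :
  (forall j, vanishes_below u (A i j)) ->
  (forall j, vanishes_below w (B j k)) ->
  vanishes_below (u + w) ((A *m B) i k).
Proof.
by move=> Au Bw; rewrite mxE; apply: vanishes_below_sum => j _;
  exact: vanishes_belowM.
Qed.

Lemma integral_prod (I : Type) (r : seq I) (f : I -> K) :
  (forall i, vanishes_below 0 (f i)) ->
  vanishes_below 0 (\prod_(i <- r) f i) /\
  (\prod_(i <- r) f i) 0 = \prod_(i <- r) f i 0.
Proof.
move=> f0; elim/big_rec2: _ => [|i y1 y2 _ [y20 <-]].
  by split; [exact: vanishes_below1|rewrite lcoef1 eqxx].
split; first by rewrite -[0]addr0; exact: vanishes_belowM.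
by rewrite -[in LHS](addr0 0) lcoefM_low.
Qed.

Lemma vanishes_below_sign (b : nat) w (f : K) :
  vanishes_below w f -> vanishes_below w ((-1) ^+ b * f).
Proof.
by rewrite -signr_odd; case: odd => fw; rewrite ?mulN1r ?mul1r//;
  exact: vanishes_belowN.
Qed.

Lemma lcoef_sign (b : nat) (f : K) i : ((-1) ^+ b * f) i = (-1) ^+ b * f i.
Proof.
by rewrite -signr_odd -[in RHS]signr_odd; case: odd; rewrite ?mulN1r ?mul1r.
Qed.

Lemma integral_det n (A : 'M[K]_n) :
  integral_mx A -> vanishes_below 0 (\det A).
Proof.
move=> A0; apply: vanishes_below_sum => s _; apply: vanishes_below_sign.
by have [] := integral_prod (index_enum _) (fun i => A0 i (s i)).
Qed.

(** Taking the coefficient of index 0 is reduction modulo U, which is multiplicative on F[[x^-1]],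
    so it passes through the Leibniz formula. *)
Lemma const_part_det n (A : 'M[K]_n) :
  integral_mx A -> (\det A) 0 = \det (const_part A).
Proof.
move=> A0; rewrite lcoef_sum; apply: eq_bigr => s _; rewrite lcoef_sign.
have [_ ->] := integral_prod (index_enum _) (fun i => A0 i (s i)).
by congr (_ * _); apply: eq_bigr => i _; rewrite mxE.
Qed.

(** Cramer's rule: the adjugate is integral, and a determinant of order 0 is a unit of F[[x^-1]]. *)
Lemma integral_invmx n (A : 'M[K]_n) : A \in unitmx -> integral_mx A ->
  lord (\det A) = 0 -> integral_mx (invmx A).
Proof.
move=> Au A0 dA i j; rewrite /invmx Au mxE -[0]addr0.
have dA0 : \det A != 0 by rewrite unitmxE unitfE in Au.
apply: vanishes_belowM.
  by apply/vanishes_below_lord; rewrite ?invr_eq0// lordV// dA oppr0.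
rewrite mxE; apply: vanishes_below_sign; apply: integral_det => k l.
by rewrite !mxE.
Qed.

(** The determinant of C is a unit of F[x], hence a nonzero constant. Invertible column operations
    over A therefore preserve deg (det T). *)
Lemma lord_det_map_poly n (C C' : 'M[{poly F}]_n) : C *m C' = 1%:M ->
  let lC := map_mx (@poly_laurent F) C in
  \det lC != 0 /\ lord (\det lC) = 0.
Proof.
move=> CC' lC; rewrite det_map_mx.
have dC : \det C * \det C' = 1 by rewrite -det_mulmx CC' det1.
have [C0 C'0] : \det C != 0 /\ \det C' != 0.
  by apply/andP; rewrite -negb_or -mulf_eq0 dC oner_neq0.
have inj0 (p : {poly F}) : p != 0 -> poly_laurent p != 0.
  by apply: contraNneq => p0; apply/eqP/poly_laurent_inj; rewrite p0 rmorph0.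
have size1 (p q : {poly F}) : p * q = 1 -> p != 0 -> q != 0 -> size p = 1%N.
  move=> pq p0 q0; have := size_mul p0 q0; rewrite pq size_poly1.
  move: p0 q0; rewrite -!size_poly_gt0 => p0 q0 /= h.
  by case: (size p) (size q) p0 q0 h => [|[|r]] [|[|s]] //=; rewrite ?addnS.
split; first exact: inj0.
have /eqP/size_poly1P[c c0 ->] := size1 _ _ dC C0 C'0.
apply: leading_index_lord; split; first by rewrite lcoef_poly lexx coefC.
have -> : (0 : int) = 1 - 1%:Z by [].
by apply/poly_laurent_below; rewrite size_polyC c0.
Qed.

End IntegralMatrices.

(** * Cardinality of boxes of polynomial vectors *)

Lemma card_finType (T : finType) : ([set: T] #= `I_#|T|)%card.
Proof.
have inj : {in [set: T] &, injective (fun x => nat_of_ord (enum_rank x))}.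
  by move=> x y _ _ /ord_inj/enum_rank_inj.
apply: card_esym; apply: card_eq_trans (inj_card_eq inj).
rewrite (_ : `I_#|T| = [set nat_of_ord (enum_rank x) | x in [set: T]]) //.
apply/seteqP; split => [k /= kT|_ [x _ <-] /=]; last exact: ltn_ord.
by exists (enum_val (Ordinal kT)) => //; rewrite enum_valK.
Qed.

(** The lowest n_j coefficients of a_j - p_j are free and the others vanish. As n_j varies with j,
    the coefficients are indexed by a disjoint union of ordinals. *)
Lemma card_poly_box (F : finFieldType) d (n : 'I_d -> nat)
    (p : 'cV[{poly F}]_d) :
  ([set a : 'cV[{poly F}]_d | forall j, (size (a j 0 - p j 0)%R <= n j)%N]
    #= `I_(#|F| ^ \sum_j n j))%card.
Proof.
pose G (g : {ffun {j : 'I_d & 'I_(n j)} -> F}) : 'cV[{poly F}]_d :=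
  \col_j (p j 0 + rVpoly (\row_(k < n j) g (Tagged (fun j => 'I_(n j)) k))).
have Ginj : {in [set: {ffun {j : 'I_d & 'I_(n j)} -> F}] &, injective G}.
  move=> g h _ _ /matrixP gh; apply/ffunP => -[j k].
  have := gh j 0; rewrite !mxE => /addrI/(congr1 (@poly_rV F (n j))).
  by rewrite !rVpolyK => /rowP/(_ k); rewrite !mxE.
rewrite (_ : [set a | _] = [set G g | g in [set: _]]).
  apply: card_eq_trans (inj_card_eq Ginj) _.
  rewrite (_ : (#|F| ^ _)%N = #|{ffun {j : 'I_d & 'I_(n j)} -> F}|).
    exact: card_finType.
  rewrite card_ffun card_tagged sumnE big_map big_enum /=; congr (_ ^ _)%N.
  by apply: eq_bigr => j _; rewrite card_ord.
apply/seteqP; split => [a /= an|_ [g _ <-] j /=]; last first.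
  by rewrite mxE addrAC subrr add0r size_poly.
exists [ffun t => (poly_rV (a (tag t) 0 - p (tag t) 0) : 'rV_(n (tag t))) 0
  (tagged t)] => //.
apply/matrixP => j k; rewrite ord1 mxE.
rewrite (_ : \row_k0 _ = poly_rV (a j 0 - p j 0)).
  by rewrite poly_rV_K// addrC subrK.
by apply/rowP => l; rewrite !mxE ffunE /= mxE.
Qed.

(** * Counting lattice points *)

Section RiemannRoch.
Variables (F : finFieldType) (d : nat).
Local Notation K := (laurent F).
Local Notation lpoly := (map_mx (@poly_laurent F)).
Implicit Types (T : 'M[K]_d) (z : 'cV[K]_d) (k : 'I_d -> int).

(* The vanishing of H^1, in the language of Riemann-Roch. *)
Definition dual_trivial T := forall y : 'rV[K]_d,
  (forall j, vanishes_below 1 (y 0 j)) ->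
  (exists p : 'rV[{poly F}]_d, y *m T = lpoly p) -> y = 0.

Definition box_points T z : set 'cV[{poly F}]_d :=
  [set a | forall j, vanishes_below 1 ((T *m lpoly a - z) j 0)].

(** Since [lord] is the opposite of the degree, n is - deg (det T). One n serves all translates
    z. *)
Definition counts T (n : nat) :=
  lord (\det T) = n%:Z /\ forall z, (box_points T z #= `I_(#|F| ^ n))%card.

(** [k j] bounds the degree of column j, and B divides that column by x^(k_j). The order of det B is
    the excess of the sum of the k_j over deg (det T). *)
Lemma integral_col_scaling T k : T \in unitmx ->
  (forall i j, vanishes_below (- k j) (T i j)) ->
  let B := T *m diag_mx (\row_j lmono F (- k j)) in
  [/\ integral_mx B, \det B != 0 & lord (\det B) = \sum_j k j + lord (\det T)].
Proof.
move=> Tu Tk B.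
have dT0 : \det T != 0 by rewrite unitmxE unitfE in Tu.
have lk j : lmono F (- k j) != 0 by exact: lmono_neq0.
have p0 : \prod_j lmono F (- k j) != 0 by apply/prodf_neq0.
have dB : \det B = \det T * \prod_j lmono F (- k j).
  rewrite det_mulmx det_diag; congr (_ * _).
  by apply: eq_bigr => j _; rewrite mxE.
split; last 2 first.
- by rewrite dB mulf_neq0.
- rewrite dB lordM// lord_prod// addrC; congr (_ + _).
  by apply: eq_bigr => j _; rewrite lord_lmono opprK.
move=> i j; rewrite /B mul_mx_diag !mxE mulrC.
by apply/vanishes_below_lmonoM; rewrite add0r.
Qed.

Lemma counts_reduced T k : T \in unitmx ->
  (forall i j, vanishes_below (- k j) (T i j)) ->
  \sum_j k j + lord (\det T) = 0 ->
  dual_trivial T -> exists n, counts T n.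
Proof.
move=> Tu Tk skT Tdual.
pose D := diag_mx (\row_j lmono F (k j)).
pose DV := diag_mx (\row_j lmono F (- k j)).
pose B := T *m DV.
have DVD : DV *m D = 1%:M.
  apply/matrixP => i j; rewrite /D mul_diag_mx !mxE.
  case: eqP => [->|]; rewrite ?mulr1n ?mulr0n ?mulr0//.
  by rewrite lmonoNK.
have TBD : T = B *m D by rewrite -mulmxA DVD mulmx1.
have [Bint dB0 lB] := integral_col_scaling Tu Tk; rewrite skT in lB.
have Bu : B \in unitmx by rewrite unitmxE unitfE.
have BVint := integral_invmx Bu Bint lB.
(* If k_i > 0, row i of B^-1 divided by x^(k_i) lies in U^d, while its product with T is the i-th
   unit vector; [dual_trivial] forbids this. *)
have k0 i : k i <= 0.
  rewrite leNgt; apply/negP => ki.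
  pose y : 'rV[K]_d := lmono F (- k i) *: row i (invmx B).
  have yT : y *m T = delta_mx 0 i.
    rewrite -scalemxAl TBD mulmxA -row_mul mulVmx// row1.
    apply/rowP => j; rewrite mxE /D mul_mx_diag !mxE eqxx /=.
    have [->|ji] := eqVneq j i; last by rewrite mul0r mulr0.
    by rewrite mul1r lmonoNK.
  have y0 : y = 0.
    apply: Tdual; last first.
      by exists (delta_mx 0 i); rewrite yT map_delta_mx.
    move=> j; rewrite !mxE; apply/vanishes_below_lmonoM.
    by apply: vanishes_belowW (BVint i j); lia.
  move/matrixP : yT => /(_ 0 i); rewrite y0 mul0mx !mxE !eqxx => /esym/eqP.
  by rewrite oner_eq0.
pose n j := `|k j|%N.
have kn j : - k j = (n j)%:Z by rewrite /n; have := k0 j; lia.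
exists (\sum_j n j)%N; split.
  move/eqP: skT; rewrite addrC addr_eq0 => /eqP ->.
  by rewrite -sumrN -natz natr_sum; apply: eq_bigr => j _; rewrite kn natz.
move=> z; have [w Bw] : exists w, B *m w = z.
  by exists (invmx B *m z); rewrite mulmxA mulmxV// mul1mx.
(* The polynomial part p_j of x^(- k_j) w_j is the centre of the box for a_j: as k_j <= 0, the
   remainder in U respects the bound deg < - k_j. *)
have /choice[p pP] : forall j, exists p : {poly F},
    vanishes_below 1 (lmono F (- k j) * w j 0 - poly_laurent p).
  by move=> j; exact: poly_part_ex.
have := card_poly_box n (\col_j p j); congr (_ #= _)%card.
have mulint (C : 'M[K]_d) (v : 'cV[K]_d) : integral_mx C ->
    (forall j, vanishes_below 1 (v j 0)) ->
    forall j, vanishes_below 1 ((C *m v) j 0).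
  move=> C0 v1 j; rewrite -[1]add0r; apply: vanishes_below_mulmx => //.
(* B and its inverse both preserve U^d, so the condition decouples into one for each a_j. *)
have boxE (a : 'cV[{poly F}]_d) : box_points T z a <->
    forall j, vanishes_below 1 ((D *m lpoly a - w) j 0).
  have BE : T *m lpoly a - z = B *m (D *m lpoly a - w).
    by rewrite mulmxBr mulmxA -TBD Bw.
  rewrite /box_points /= BE; split => [h|]; last exact: mulint.
  by rewrite -[_ - w](mulKmx Bu); exact: mulint.
have shiftE (a : {poly F}) j :
    vanishes_below (1 + k j) (poly_laurent a - lmono F (- k j) * w j 0) <->
    vanishes_below 1 (lmono F (k j) * poly_laurent a - w j 0).
  rewrite -vanishes_below_lmonoM mulrBr mulrA.
  by rewrite -lmonoD subrr lmono0 mul1r.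
have pP' j : vanishes_below (1 + k j)
    (lmono F (- k j) * w j 0 - poly_laurent (p j)).
  by apply: vanishes_belowW (pP j); rewrite gerDl.
have kE j : 1 + k j = 1 - (n j)%:Z by rewrite -kn opprK.
apply/seteqP; split => a /= h.
  apply/boxE => j; rewrite /D mul_diag_mx !mxE; apply/shiftE.
  have := h j; rewrite mxE => /poly_laurent_below; rewrite raddfB -kE => h1.
    rewrite -(subrKA (poly_laurent (p j)) (poly_laurent (a j 0))).
  apply: vanishes_belowD h1 _; rewrite -opprB; exact: vanishes_belowN.
move=> j; apply/poly_laurent_below; rewrite mxE raddfB -kE.
move/boxE: h => /(_ j); rewrite /D mul_diag_mx !mxE => /shiftE h1.
rewrite -(subrKA (lmono F (- k j) * w j 0) (poly_laurent (a j 0))).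
exact: vanishes_belowD.
Qed.

(* A column operation lowering one column degree exists as soon as the leading
   coefficients of the columns are linearly dependent over F. *)
Lemma column_reduction T k : T \in unitmx ->
  (forall i j, vanishes_below (- k j) (T i j)) ->
  0 < \sum_j k j + lord (\det T) ->
  exists (C C' : 'M[{poly F}]_d) (k' : 'I_d -> int),
    [/\ C *m C' = 1%:M, \sum_j k' j = \sum_j k j - 1 &
        forall i j, vanishes_below (- k' j) ((T *m lpoly C) i j)].
Proof.
move=> Tu Tk skT.
pose B := T *m diag_mx (\row_j lmono F (- k j)).
have [Bint dB lB] := integral_col_scaling Tu Tk.
(* A positive order of det B makes the matrix of the coefficients of x^(k_j) in the columns of T
   singular; v is a linear relation between its columns. *)
have dB0 : (\det B) 0 = 0.
  by have [_] := lordP dB; apply; rewrite lB.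
have /eqP := dB0; rewrite const_part_det// -det_tr => /det0P[v v0 vB].
have /rV0Pn[i1 vi1] := v0.
(* Maximality of k_i0 on the support of v makes each needed x^(k_i0 - k_i) a polynomial. Off the
   support the absolute value in [e] is harmless, since the coefficient is 0. *)
case: (@arg_maxP _ _ _ i1 (fun i => v 0 i != 0) k vi1) => i0 vi0 kmax.
pose e i : nat := `|k i0 - k i|%N.
pose u : 'cV[{poly F}]_d :=
  \col_i (if i == i0 then 0 else (v 0 i / v 0 i0)%:P * 'X^(e i)).
pose N : 'M[{poly F}]_d := u *m delta_mx 0 i0.
have Nij i j : N i j = u i 0 * (j == i0)%:R.
  by rewrite mxE big_ord1 [delta_mx _ _ _ _]mxE.
have ui0 : u i0 0 = 0 by rewrite mxE eqxx.
(* N only feeds column i0 and u vanishes at i0, so N is nilpotent and 1 - N inverts 1 + N. *)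
have NN : N *m N = 0.
  apply/matrixP => i j; rewrite mxE [RHS]mxE big1// => l _; rewrite !Nij.
  by have [->|_] := eqVneq l i0; rewrite ?mulr0 ?mul0r// ui0 mul0r mulr0.
exists (1%:M + N), (1%:M - N), (fun j => k j - (j == i0)%:R); split.
- by rewrite mulmxDl mul1mx mulmxBr mulmx1 NN subr0 subrK.
- rewrite sumrB; congr (_ - _); rewrite (bigD1 i0)//= eqxx big1 ?addr0//.
  by move=> j /negbTE ->.
move=> i j; rewrite map_mxD map_mx1 mulmxDr mulmx1 mxE.
have [->|ji0] := eqVneq j i0; last first.
  rewrite [(T *m lpoly N) i j]mxE big1 ?addr0 ?subr0; first exact: Tk.
  by move=> l _; rewrite mxE Nij (negbTE ji0) mulr0 rmorph0 mulr0.
have -> : T i i0 + (T *m lpoly N) i i0 =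
    \sum_l lmono F (e l)%:Z * (poly_laurent (v 0 l / v 0 i0)%:P * T i l).
  rewrite [(T *m lpoly N) i i0]mxE (bigD1 i0)//= [RHS](bigD1 i0)//=.
  rewrite [lpoly N i0 i0]mxE Nij ui0 mul0r rmorph0 mulr0 add0r.
  rewrite /e subrr lmono0 mul1r divff// rmorph1 mul1r; congr (_ + _).
  apply: eq_bigr => l li0; rewrite mxE Nij eqxx mulr1 [u l 0]mxE (negbTE li0).
  by rewrite rmorphM /= poly_laurentXn mulrC [in RHS]mulrA [_ * lmono _ _]mulrC.
(* Up to index - k_i0 only that index can contribute to the new column, and there the terms sum to a
   multiple of the relation v, hence to 0: the degree bound drops by one. *)
have coefE l m : m < - k i0 + 1 ->
    (lmono F (e l)%:Z * (poly_laurent (v 0 l / v 0 i0)%:P * T i l)) m =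
    (v 0 i0)^-1 * ((m == - k i0)%:R * (v 0 l * B i l 0)).
  move=> mk; rewrite lcoef_lmonoM poly_laurentC_M.
  have [->|vl] := eqVneq (v 0 l) 0; first by rewrite !(mul0r, mulr0).
  rewrite [v 0 l / _]mulrC -mulrA; congr (_ * _).
  have kl : k l <= k i0 := kmax l vl.
  have -> : m + (e l)%:Z = m + k i0 - k l by rewrite /e; lia.
  have -> : B i l 0 = T i l (- k l).
    by rewrite /B mul_mx_diag !mxE mulrC lcoef_lmonoM add0r.
  have [->|mk'] := eqVneq m (- k i0); first by rewrite addNr add0r mul1r.
  by rewrite mul0r Tk ?mulr0//; lia.
move=> m mk; rewrite lcoef_sum.
rewrite (eq_bigr _ (fun l _ => coefE l m _)); last first.
  by move: mk; rewrite opprB addrC.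
rewrite -!mulr_sumr.
move/matrixP : vB => /(_ 0 i); rewrite mxE [RHS]mxE => vB.
rewrite (_ : \sum_l v 0 l * B i l 0 = 0) ?mulr0// -[RHS]vB.
by apply: eq_bigr => l _; rewrite !mxE.
Qed.

(** T and T C span the same lattice: multiplication by C is a bijection of A^d, and det C has order
    0. *)
Lemma counts_mul_poly T (C C' : 'M[{poly F}]_d) n : T \in unitmx ->
  C *m C' = 1%:M -> counts (T *m lpoly C) n -> counts T n.
Proof.
move=> Tu CC' [lTC cTC].
have dT0 : \det T != 0 by rewrite unitmxE unitfE in Tu.
have [dC0 lC] := lord_det_map_poly CC'.
split; first by rewrite -lTC det_mulmx lordM// lC addr0.
move=> z; have C'C := mulmx1C CC'.
have Cinj : {in box_points (T *m lpoly C) z &, injective (fun a => C *m a)}.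
  by move=> a b _ _ /(congr1 (mulmx C')); rewrite !mulmxA C'C !mul1mx.
have := card_eq_trans (inj_card_eq Cinj) (cTC z).
rewrite (_ : [set _ | _ in _] = box_points T z)//.
apply/seteqP; split => [_ [a aP <-]|a aP].
  by move=> j; have := aP j; rewrite map_mxM mulmxA.
exists (C' *m a); last by rewrite -[RHS]mul1mx -CC'; exact: mulmxA.
move=> j; have := aP j.
by rewrite -mulmxA -map_mxM [C *m _]mulmxA CC' mul1mx.
Qed.

Lemma dual_trivial_mul_poly T (C C' : 'M[{poly F}]_d) :
  C *m C' = 1%:M -> dual_trivial T -> dual_trivial (T *m lpoly C).
Proof.
move=> CC' Td y y1 [p yTC]; apply: Td => //; exists (p *m C').
by rewrite map_mxM -yTC -!mulmxA -map_mxM CC' map_mx1 mulmx1.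
Qed.

Lemma riemann_roch T : T \in unitmx -> dual_trivial T ->
  exists n, counts T n.
Proof.
move=> Tu Td.
have [k Tk] : exists k, forall i j, vanishes_below (- k j) (T i j).
  have /choice[w wP] : forall p : 'I_d * 'I_d,
      exists w, vanishes_below w (T p.1 p.2).
    by move=> p; exact: laurent_bound.
  exists (fun _ => \sum_p `|w p|%N%:Z) => i j.
  apply: vanishes_belowW (wP (i, j)).
  have : (`|w (i, j)|%N%:Z : int) <= \sum_p `|w p|%N%:Z.
    by rewrite (bigD1 (i, j))//= lerDl sumr_ge0.
  by lia.
(* Induction on the defect, the sum of the k_j minus deg (det T). It cannot be negative, because an
   integral matrix has a determinant of order at least 0. *)
have [n] := ubnP (absz (\sum_j k j + lord (\det T))%R).
elim: n => // n IH in T k Tu Td Tk *; rewrite ltnS => skn.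
have [sk0|sk0|sk0] := ltgtP (\sum_j k j + lord (\det T)) 0.
- have [Bint dB lB] := integral_col_scaling Tu Tk.
  have := integral_det Bint; rewrite vanishes_below_lord// lB.
  by rewrite leNgt sk0.
- have [C [C' [k' [CC' sk' TCk']]]] := column_reduction Tu Tk sk0.
  have dT0 : \det T != 0 by rewrite unitmxE unitfE in Tu.
  have [dC0 lC] := lord_det_map_poly CC'.
  have [||//||m mP] := IH (T *m lpoly C) k'.
  + by rewrite unitmxE det_mulmx unitfE mulf_neq0.
  + exact: dual_trivial_mul_poly CC' Td.
  + rewrite sk' det_mulmx lordM// lC addr0 addrAC.
    move: skn sk0; set s := _ + lord _; clearbody s; lia.
  by exists m; exact: counts_mul_poly CC' mP.
- exact: counts_reduced Tk sk0 Td.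
Qed.

End RiemannRoch.

(** * Elementary boxes, dual vectors and the lattice minimum *)

Section LatticeCounting.
Variables (F : finFieldType) (d : nat).
Local Notation K := (laurent F).
Local Notation lpoly := (map_mx (@poly_laurent F)).
Implicit Types (T : 'M[K]_d) (f g h : 'cV[K]_d) (l : 'I_d -> int).

(** This is [riemann_roch] for S T with S = diag (x^(l_j) / f_j), which turns the box around h into
    a translate of U^d. The l_j are integers, possibly negative, so that the total volume can be
    prescribed freely. *)
Lemma card_shrunk_box T f l : T \in unitmx -> (forall j, f j 0 != 0) ->
  (forall y : 'rV[K]_d,
     (forall j, vanishes_below (1 - l j - lord (f j 0)) (y 0 j)) ->
     (exists p : 'rV[{poly F}]_d, y *m T = lpoly p) -> y = 0) ->
  exists n : nat, lord (\det T) - \sum_j (l j + lord (f j 0)) = n%:Z /\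
    forall h, ((inv_scale f (lattice T) `&`
       [set g | forall j, vanishes_below (1 + l j) (g j 0%R - h j 0%R)%R])
       #= `I_(#|F| ^ n))%card.
Proof.
move=> Tu f0 Tdual.
pose s j := lmono F (l j) * (f j 0)^-1.
have s0 j : s j != 0 by rewrite mulf_neq0 ?invr_eq0 ?lmono_neq0.
have ls j : lord (s j) = - (l j + lord (f j 0)).
  by rewrite lordM ?invr_eq0 ?lmono_neq0// lord_lmono lordV// opprD.
pose S := diag_mx (\row_j s j).
have dS : \det S = \prod_j s j.
  by rewrite det_diag; apply: eq_bigr => j _; rewrite mxE.
have dS0 : \det S != 0 by rewrite dS; apply/prodf_neq0.
have dT0 : \det T != 0 by rewrite unitmxE unitfE in Tu.
have STu : S *m T \in unitmx by rewrite unitmxE det_mulmx unitfE mulf_neq0.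
have [|n [lST cST]] := riemann_roch STu.
  (* Multiplying y by S shifts the bound on entry j by the order of s_j, which gives exactly the
     assumed bound. *)
  move=> y y1 [p yp]; have yS : y *m S = 0.
    apply: Tdual; last by exists p; rewrite -mulmxA.
    move=> j; rewrite mul_mx_diag !mxE.
    rewrite (_ : 1 - _ - _ = 1 + lord (s j)); last by rewrite ls opprD addrA.
    by apply: vanishes_belowM => //; have [] := lordP (s0 j).
  have Su : S \in unitmx by rewrite unitmxE unitfE.
  by rewrite -[y](mulmxK Su) yS mul0mx.
exists n; split.
  rewrite -lST det_mulmx lordM// dS lord_prod// addrC -sumrN; congr (_ + _).
  by apply: eq_bigr => j _; rewrite ls.
move=> h.
pose G (a : 'cV[{poly F}]_d) : 'cV[K]_d :=
  \col_j ((f j 0)^-1 * (T *m lpoly a) j 0).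
have Ginj : injective G.
  move=> a a' /matrixP GG; suff /(congr1 (mulmx (invmx T))) :
      T *m lpoly a = T *m lpoly a'.
    rewrite !(mulKmx Tu) => /matrixP aa; apply/matrixP => i k.
    by apply: poly_laurent_inj; have := aa i k; rewrite !mxE.
  apply/matrixP => j k; rewrite ord1; have := GG j 0; rewrite mxE [RHS]mxE.
  by move/(mulfI _); apply; rewrite invr_eq0.
pose z : 'cV[K]_d := \col_j (lmono F (l j) * h j 0).
have GP a j : (S *m T *m lpoly a - z) j 0 = lmono F (l j) * (G a j 0 - h j 0).
  have subE (A B : 'cV[K]_d) : (A - B) j 0 = A j 0 - B j 0 by rewrite !mxE.
  rewrite subE [z j 0]mxE [G a j 0]mxE -mulmxA.
  rewrite [(S *m _) j 0](_ : _ = s j * (T *m lpoly a) j 0).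
    by rewrite mulrBr mulrA.
  by rewrite /S mul_diag_mx mxE [(\row_j0 _) _ _]mxE.
have := card_eq_trans (inj_card_eq (in2W Ginj)) (cST z).
congr (_ #= _)%card; apply/seteqP.
split => [_ [a aP <-]|_ [[_ [a _ <-] <-]] /= aP].
  split; first by exists (T *m lpoly a) => //; exists a.
  by move=> j; apply/vanishes_below_lmonoM; rewrite -GP; exact: aP.
exists a => // j; rewrite GP; apply/vanishes_below_lmonoM; exact: aP.
Qed.

(** Pairing y with T a gives (y T) a, a polynomial. In this way a failure of [dual_trivial] produces
    dual vectors. *)
Lemma dual_lattice T (y : 'rV[K]_d) :
  (exists p : 'rV[{poly F}]_d, y *m T = lpoly p) -> dual (lattice T) y^T.
Proof.
move=> [p yT] _ [a _ <-]; exists ((p *m a) 0 0) => //.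
transitivity ((y *m (T *m lpoly a)) 0 0); last first.
  by rewrite [LHS]mxE; apply: eq_bigr => j _; rewrite [y^T j 0]mxE.
by rewrite mulmxA yT -map_mxM [RHS]mxE.
Qed.

Lemma degsum_le (w : 'I_d -> int) g :
  (forall j, vanishes_below (w j) (g j 0)) ->
  (degsum g <= (- \sum_j w j)%:E)%E.
Proof.
move=> gw; rewrite -sumrN -sumEFin; apply: lee_sum => j _.
by apply/deg_le; rewrite opprK.
Qed.

(* The analogue of Minkowski's first theorem for the dual lattice. *)
Lemma dual_short_vector T : (0 < d)%N -> T \in unitmx ->
  exists2 g, (dual (lattice T) `\ 0) g &
    (degsum g <= (lord (\det T) - d%:Z + 1)%:E)%E.
Proof.
move=> d0 Tu; pose i0 := Ordinal d0.
(* The l_j sum to one more than the order of det T, so a count would have exponent -1. Hence some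
   nonzero y violates the hypothesis of [card_shrunk_box]. *)
pose l (j : 'I_d) : int := if j == i0 then lord (\det T) + 1 else 0.
have sl : \sum_j l j = lord (\det T) + 1.
  rewrite (bigD1 i0)//= big1 ?addr0 /l ?eqxx//.
  by move=> j /negbTE ->.
have [y [yl yT y0]] : exists y : 'rV[K]_d,
    [/\ forall j, vanishes_below (1 - l j) (y 0 j),
        exists p : 'rV[{poly F}]_d, y *m T = lpoly p & y <> 0].
  apply: contrapT => yN.
  have [j|y yl yT|n [+ _]] := @card_shrunk_box T (const_mx 1) l Tu.
  - by rewrite mxE oner_neq0.
  - apply: contrapT => y0; apply: yN; exists y; split => // j.
    by have := yl j; rewrite mxE lord1 subr0.
  rewrite (eq_bigr l) ?sl; last by move=> j _; rewrite mxE lord1 addr0.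
  by rewrite opprD addrA subrr.
exists y^T.
  split; first exact: dual_lattice.
  by move=> /(congr1 trmx); rewrite trmxK trmx0.
rewrite (_ : lord _ - _ + _ = - \sum_j (1 - l j)).
  by apply: degsum_le => j; rewrite mxE.
rewrite sumrB sl sumr_const card_ord opprB addrAC.
by congr (_ - _); rewrite natz.
Qed.

(** [infimum] falls back on its default when no infimum exists, so existence is proved first: it is
    -oo without an integer lower bound, and otherwise a least element by well-ordering. *)
Lemma lattice_minP T : (0 < d)%N -> T \in unitmx -> admissible (lattice T) ->
  exists2 M : int, lattice_min (lattice T) = M%:E &
    forall g, (dual (lattice T) `\ 0) g -> (M%:E <= degsum g)%E.
Proof.
move=> d0 Tu; rewrite /admissible /lattice_min.
set S := [set degsum x | x in _].
have [g0 g0dual g0deg] := dual_short_vector d0 Tu.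
have Sg0 : S (degsum g0) by exists g0.
have inf_ex : exists x, infimums S x.
  have [[m mS]|mN] := pselect (exists m : int, lbound S m%:E); last first.
    exists -oo%E; split => [x _|]; first exact: leNye.
    case=> [m mS|lbS|_]; [by case: mN; exists m| |exact: lexx].
    by case: mN; exists 0 => x Sx; exact: le_trans (leey _) (lbS x Sx).
  have ex : exists n : nat, `[< S (m + n%:Z)%:E >].
    case: (degsum g0) Sg0 g0deg (mS _ Sg0) => [c Sc _|_|_ _]; last 2 first.
    - by rewrite leye_eq.
    - by rewrite leeNy_eq.
    rewrite lee_fin => mc.
    by exists `|c - m|%N; apply/asboolP; rewrite (_ : m + _ = c)//; lia.
  case: (ex_minnP ex) => n /asboolP Sn nmin.
  exists (m + n%:Z)%:E; split => [x Sx|y /(_ _ Sn)//].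
  case: x Sx (mS _ Sx) => [c Sc|_ _|_]; last 2 first.
  - exact: leey.
  - by rewrite leeNy_eq.
  rewrite !lee_fin => mc.
  have /nmin : `[< S (m + `|c - m|%N%:Z)%:E >].
    by apply/asboolP; rewrite (_ : m + _ = c)//; lia.
  by lia.
have S0 : S != set0 by apply/set0P; exists (degsum g0).
rewrite /infimum (negbTE S0).
have [lb _] := @xgetPex _ +oo%E _ inf_ex.
(* Admissibility excludes -oo, and the short dual vector excludes +oo. *)
case: (xget _ _) lb => [M||//] lb _; last first.
  by have := le_trans (lb _ Sg0) g0deg; rewrite leye_eq.
by exists M => // g gdual; apply: lb; exists g.
Qed.

End LatticeCounting.
(** * The net property *)

(** Needed for the nodes to lie in the unit cube. The partial sums are nondecreasing and bounded by
    1, so the limit exists and inherits the bounds. *)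
Lemma phi_itv (R : realType) (b : nat) (f : laurent 'F_b) : prime b ->
  vanishes_below 1 f -> 0 <= phi R f <= 1.
Proof.
move=> b_prime f1; set w := lord f.
have b0 : 0 < b%:R :> R by rewrite ltr0n prime_gt0.
have bn0 : b%:R != 0 :> R by rewrite gt_eqF.
have b1 : 1 <= b%:R :> R by rewrite ler1n prime_gt0.
pose term k : R := (nat_of_ord (f (w + k%:Z)))%:R * b%:R ^ (- (w + k%:Z)).
have term0 k : 0 <= term k.
  by rewrite mulr_ge0// exprz_ge0// ltW.
pose S n := \sum_(0 <= k < n) term k.
have S0 n : 0 <= S n by apply: sumr_ge0.
have S1 n : S n <= 1.
  have [f0|f0] := eqVneq f 0.
    by rewrite /S big1// => k _; rewrite /term f0 mul0r.
  have w1 : 1 <= w by apply/vanishes_below_lord.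
  (* Digits are at most b - 1, so term k is at most b^(1 - w - k) - b^(- w - k), and the sum
     telescopes. *)
  have Sw : S n <= b%:R ^ (1 - w) - b%:R ^ (1 - w - n%:Z).
    elim: n => [|n IH]; first by rewrite /S big_nil subr0 subrr.
    rewrite /S big_nat_recr//= -/(S n); apply: le_trans (lerD IH (lexx _)) _.
    have -> : 1 - w - n%:Z = 1 + (- (w + n%:Z)) by lia.
    have -> : 1 - w - n.+1%:Z = - (w + n%:Z) by lia.
    have tB : term n + b%:R ^ (- (w + n%:Z)) <= b%:R ^ (1 + - (w + n%:Z)).
      rewrite expfzDr// expr1z -[X in _ + X <= _]mul1r -mulrDl.
      rewrite ler_wpM2r ?exprz_ge0 ?(ltW b0)// natr1 ler_nat.
      have := ltn_ord (f (w + n%:Z)).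
      by rewrite [X in (_ < X)%N]Fp_cast.
    by move: tB; clear; lra.
  apply: le_trans Sw _; rewrite lerBlDr; apply: (@le_trans _ _ 1).
    by rewrite -(expr0z (b%:R : R)) ler_weXz2l//; lia.
  by rewrite lerDl exprz_ge0// ltW.
have Scvg : cvgn S.
  apply: nondecreasing_is_cvgn; last by exists 1 => _ [n _ <-].
  by apply/nondecreasing_seqP => n; rewrite /S big_nat_recr//= lerDl.
rewrite (_ : phi R f = limn S)//.
by apply/andP; split; [apply: limr_ge|apply: limr_le] => //; exact: nearW.
Qed.

Theorem theorem3p7 (R : realType) (b d : nat) (b_prime : prime b)
    (d_gt0 : (1 <= d)%N) (T L Q : 'M[laurent 'F_b]_d)
    (T_unit : T \in unitmx) (T_adm : admissible (lattice T))
    (T_LQ : T = L *m Q) (L_lower : is_trig_mx L)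
    (Q_int : forall i j, power_series (Q i j)) (Q_det : \det Q = 1) :
  exists t : nat,
    (t%:Z%:E = - deg (\det T) - lattice_min (lattice T) - d%:Z%:E + 1)%E /\
    forall f : 'cV[laurent 'F_b]_d,
      (forall j, (0 <= deg (f j 0%R))%E) ->
      (forall j : 'I_d,
         (\big[maxe/-oo]_(i < d | (i <= j)%N) deg (L j i) <= deg (f j 0%R))%E) ->
      let P := shrunk_points T f in
      let m : \bar int := (- deg (\det T) + \sum_j deg (f j 0%R))%E in
      [/\ (1 <= m)%E -> (t%:Z%:E <= m)%E ->
            exists2 m' : nat, m'%:Z%:E = m & is_net t m' P,
          finite_set P,
          forall psi : 'cV[R]_d -> R, cubature (shrunk_rule R T f) psi =
            b%:R ^ fine (deg (\det T)) / b%:R ^ fine (\sum_j deg (f j 0%R))%E *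
            \sum_(g \in P) psi (map_mx (@phi R b) g),
          is_qmc (shrunk_rule R T f) &
          b%:R ^ (fine (deg (\det T)) - fine (\sum_j deg (f j 0%R))%E) =
            (#|` fset_set P|)%:R^-1 :> R].
Proof.
have dT0 : \det T != 0 by rewrite unitmxE unitfE in T_unit.
have [M ME Mlb] := lattice_minP d_gt0 T_unit T_adm.
have [g0 g0dual g0deg] := dual_short_vector d_gt0 T_unit.
(* This bound on M says precisely that t >= 0. *)
have Mle : M <= lord (\det T) - d%:Z + 1.
  by have := le_trans (Mlb _ g0dual) g0deg; rewrite lee_fin.
have degT : deg (\det T) = (- lord (\det T))%:E by exact: degE.
have [t tE] : exists t : nat, t%:Z = lord (\det T) - M - d%:Z + 1.
  by exists (absz (lord (\det T) - M - d%:Z + 1)%R); lia.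
exists t; split; first by rewrite ME degT tE /= opprK.
move=> f f_ge0 fL P m.
have f0 j : f j 0 != 0.
  by apply/eqP => fj; have := f_ge0 j; rewrite /deg fj eqxx leeNy_eq.
have degf : (\sum_j deg (f j 0%R))%E = (- \sum_j lord (f j 0))%:E.
  by rewrite -sumrN -sumEFin; apply: eq_bigr => j _; rewrite degE.
have cardF : #|'F_b| = b by rewrite card_Fp.
have PE : P = inv_scale f (lattice T) `&` @unit_box 'F_b d by [].
have unitP (g : 'cV[laurent 'F_b]_d) :
    unit_box g <-> forall j, vanishes_below 1 (g j 0).
  by split => g1 j; have := g1 j; rewrite deg_lt subr0.
(* The case l = 0 counts all of P. Row j of L has degree at most deg f_j, so y L lies in U^d; then y
   T = (y L) Q is both polynomial and in U^d, hence 0. *)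
have [|n [nE cP]] := @card_shrunk_box _ _ T f (fun _ => 0) T_unit f0.
  move=> y yf [p yT].
  have Lf i j : vanishes_below (lord (f j 0)) (L j i).
    have [ij|ji] := leqP i j; last by rewrite (is_trig_mxP L_lower).
    rewrite -[lord _]opprK; apply/deg_le; rewrite -degE//.
    apply: le_trans (fL j).
    exact: (@le_bigmax_cond _ _ _ _ i (fun i : 'I_d => (i <= j)%N)).
  have yL k i : vanishes_below 1 ((y *m L) k i).
    rewrite mxE; apply: vanishes_below_sum => j _; rewrite ord1.
    rewrite (_ : 1 = 1 - 0 - lord (f j 0) + lord (f j 0)).
      exact: vanishes_belowM.
    by rewrite subr0 subrK.
  have Q0 i j : vanishes_below 0 (Q i j).
    by rewrite -oppr0; apply/deg_le; exact: Q_int.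
  suff p0 : p = 0 by rewrite -[y](mulmxK T_unit) yT p0 map_mx0 mul0mx.
  apply/matrixP => i j; rewrite [RHS]mxE; apply: poly_laurent_small.
  rewrite (_ : poly_laurent _ = (y *m T) i j); last by rewrite yT mxE.
  rewrite T_LQ mulmxA -[1]addr0; exact: vanishes_below_mulmx.
have cardP : (P #= `I_(b ^ n))%card.
  have := cP 0; rewrite cardF; congr (_ #= _)%card.
  rewrite PE; congr (_ `&` _); apply/seteqP; split => g g1.
    by apply/unitP => j; have := g1 j; rewrite mxE (subr0 (g j 0)).
  by move=> j; rewrite mxE (subr0 (g j 0)); move/unitP: g1 => /(_ j).
have Pfin : finite_set P by exists (b ^ n)%N.
have sizeP : #|` fset_set P| = (b ^ n)%N by exact: card_fset_set.
have nE' : n%:Z = lord (\det T) - \sum_j lord (f j 0).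
  by rewrite -nE; congr (_ - _); apply: eq_bigr => j _; rewrite add0r.
have mE : m = n%:Z%:E by rewrite /m degT degf /= opprK nE'.
have b_neq0 : b%:R != 0 :> R by rewrite pnatr_eq0 -lt0n prime_gt0.
have weight : shrunk_weight R T f = (#|` fset_set P|)%:R^-1.
  rewrite /shrunk_weight degT degf /= invr_expz -expfzDr// sizeP natrX.
  by rewrite exprnP invr_expz nE' opprK opprB addrC.
split => //.
- move=> m1 tm; exists n => //; rewrite mE !lee_fin in m1 tm.
  have tn : (t <= n)%N by move: tm; rewrite lez_nat.
  split => //; [by rewrite PE; exact: subIsetr|].
  move=> l h sl hl.
  have slZ : \sum_j (l j)%:Z = n%:Z - t%:Z.
    have := congr1 Posz sl; rewrite -subzn//.
    by rewrite -natz natr_sum => <-; apply: eq_bigr => j _; rewrite natz.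
  (* A nonzero y would be a dual vector of degree sum at most (n - t) - d plus the sum of the
     [lord (f j 0)], which is M - 1 by the choice of t. *)
  have [|k [kE ck]] := @card_shrunk_box _ _ T f (fun j => (l j)%:Z) T_unit f0.
    move=> y yl yT; apply: contrapT => y0.
    have := Mlb y^T; rewrite leNgt => /(_ _)/negP; apply.
      split; first exact: dual_lattice.
      by move=> /(congr1 trmx); rewrite trmxK trmx0.
    apply: (@le_lt_trans _ _ (- \sum_j (1 - (l j)%:Z - lord (f j 0)))%:E).
      by apply: degsum_le => j; rewrite mxE; exact: yl.
    rewrite !sumrB slZ sumr_const card_ord natz lte_fin.
    by move: nE' tE; set s := \sum_j _; set u := lord (\det T); lia.
  have kt : k = t.
    have : k%:Z = lord (\det T) - \sum_j ((l j)%:Z + lord (f j 0)).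
      by rewrite -kE.
    rewrite big_split /= slZ => kE'; apply/eqP; rewrite -eqz_nat; apply/eqP.
    by rewrite kE' nE' [_ - t%:Z + _]addrAC subrK opprB addrC subrK.
  have := ck h; rewrite cardF kt; congr (_ #= _)%card.
  have h1 j : vanishes_below 1 (h j 0).
    by move=> i i1; apply: hl; rewrite negb_and -ltNge i1.
  have boxE (g : 'cV[laurent 'F_b]_d) j :
      vanishes_below (1 + (l j)%:Z) (g j 0 - h j 0) <->
      (deg (g j 0 - h j 0)%R < (- (l j)%:Z)%:E)%E.
    by rewrite deg_lt opprK.
  apply/seteqP; split => [g /= [gX gl]|g /= [[gU gl] [gX _]]]; last first.
    by split=> // j; apply/boxE.
  (* Both h_j and g_j - h_j lie in U, so the box around h stays inside the unit box. *)
  have gU : unit_box g.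
    apply/unitP => j; rewrite -[g j 0](subrK (h j 0)).
    by apply: vanishes_belowD => //; apply: vanishes_belowW (gl j); lia.
  by split => //; split => // j; apply/boxE.
- move=> psi; rewrite /cubature /shrunk_rule big_map fsbig_finite//.
  by rewrite big_distrr.
- have szR : size (shrunk_rule R T f) = (b ^ n)%N by rewrite size_map.
  split; first by rewrite szR expn_gt0 prime_gt0.
    move=> p /mapP[g gP ->] j /=; rewrite mxE; apply: phi_itv => //.
    by move: gP; rewrite in_fset_set// inE => -[_ /unitP].
  by move=> p /mapP[g gP ->]; rewrite szR -sizeP.
- by rewrite -weight /shrunk_weight expfzDr// invr_expz.
Qed.
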